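(* Let $\lambda\neq0$, let $\Theta\subset\mathbb{R}^d$ be an open convex set, let $\varphi:\Theta\to\mathbb{R}$ be a regular $c_\lambda$-convex function, and let $f:\Theta\to\mathbb{R}$ be continuously differentiable and convex. Let $(\theta_t)_{t\ge0}$ in $\Theta$ be the solution of the gradient flow $$\frac{d}{dt}\theta_t=-G_\lambda(\theta_t)^{-1}\nabla_\theta f(\theta_t)$$ with initial value $\theta_0\in\Theta$. Define $\tau_t=\int_0^te^{\lambda\varphi(\theta_s)}\,ds$, so that $\dot\tau_t=\frac{d}{dt}\tau_t=e^{\lambda\varphi(\theta_t)}$, and let, for $t>0$, $$\hat\theta_t=\frac1{\tau_t}\int_0^t\theta_s\,\dot\tau_s\,ds.$$ If $\theta^*\in\Theta$ is a minimizer of $f$ over $\Theta$, then $$f(\hat\theta_t)-f(\theta^* )\le\frac{\mathbf{B}_{\Phi_\lambda}[\theta^*:\theta_0]}{\tau_t},$$ where $\Phi_\lambda=\frac1\lambda(e^{\lambda\varphi}-1)$ is the Bregman generator. In particular, if $f$ is strictly convex, then $f(\hat\theta_t)-f(\theta^* )=O(\frac1t)$ as $t\to\infty$.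
   Context: Vectors are column vectors, $\langle\cdot,\cdot\rangle$ is the Euclidean inner product, $\nabla_\theta$ is the Euclidean gradient. Fix $\lambda\neq0$. Regular $c_\lambda$-convex function: a smooth function $\varphi:\Theta\to\mathbb{R}$ on an open convex set $\Theta\subset\mathbb{R}^d$ such that $\Phi_\lambda=\frac1\lambda(e^{\lambda\varphi}-1)$ is convex with $\nabla^2_\theta\Phi_\lambda$ positive definite everywhere, and $1-\lambda\langle\nabla_\theta\varphi(\theta),\theta\rangle>0$ for all $\theta\in\Theta$. The Riemannian metric induced by the $\lambda$-logarithmic divergence of $\varphi$ has, in the coordinates $\theta$, the matrix $$G_\lambda(\theta)=\nabla^2_\theta\varphi(\theta)+\lambda(\nabla_\theta\varphi(\theta))(\nabla_\theta\varphi(\theta))^\top=e^{-\lambda\varphi(\theta)}\nabla^2_\theta\Phi_\lambda(\theta).$$ The Bregman divergence of a smooth convex $\phi:\Theta\to\mathbb{R}$ is $\mathbf{B}_\phi[\theta:\theta']=\phi(\theta)-\phi(\theta')-\langle\nabla\phi(\theta'),\theta-\theta'\rangle$.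
   Formalization: In the final O(1/t) claim it is additionally assumed that the closure of the trajectory {θ_t : t≥0} is contained in Θ; without this the claim fails, since the flow can approach the boundary of Θ with τ_t bounded. *)

(* Defs.v *)
From HB Require Import structures.
From mathcomp Require Export all_boot all_order all_algebra.
From mathcomp Require Export all_classical all_reals all_analysis.
Set Implicit Arguments.
Unset Strict Implicit.
Unset Printing Implicit Defensive.
Export Order.TTheory GRing.Theory Num.Theory.
Export numFieldNormedType.Exports.
Open Scope classical_set_scope.
Open Scope ring_scope.

(* Functions on an open set [Theta] of R^d are total functions on ['cV[R]_d];
   only their values on [Theta] matter in what follows. *)

Definition inner (R : realType) (d : nat) (u v : 'cV[R]_d) : R :=
  \sum_(i < d) u i 0 * v i 0.

Definition pderiv (R : realType) (d : nat) (i : 'I_d) (g : 'cV[R]_d -> R)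
    (x : 'cV[R]_d) : R :=
  'D_(delta_mx i 0) g x.

Definition grad (R : realType) (d : nat) (g : 'cV[R]_d -> R)
    (x : 'cV[R]_d) : 'cV[R]_d :=
  \col_(i < d) pderiv i g x.

Definition hessian (R : realType) (d : nat) (g : 'cV[R]_d -> R)
    (x : 'cV[R]_d) : 'M[R]_d :=
  \matrix_(i < d, j < d) pderiv j (pderiv i g) x.

Definition posdefmx (R : realType) (d : nat) (A : 'M[R]_d) : Prop :=
  A^T = A /\ forall v : 'cV[R]_d, v != 0 -> 0 < inner v (A *m v).

Fixpoint Ck (R : realType) (d k : nat) (Theta : set 'cV[R]_d)
    (g : 'cV[R]_d -> R) : Prop :=
  match k with
  | 0%N => forall x, Theta x -> {for x, continuous g}
  | k'.+1 => (forall x, Theta x -> differentiable g x) /\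
             (forall i : 'I_d, Ck k' Theta (pderiv i g))
  end.

Definition smooth (R : realType) (d : nat) (Theta : set 'cV[R]_d)
    (g : 'cV[R]_d -> R) : Prop :=
  forall k : nat, Ck k Theta g.

Definition strictly_convex (R : realType) (d : nat) (Theta : set 'cV[R]_d)
    (g : 'cV[R]_d -> R) : Prop :=
  forall (x y : 'cV[R]_d) (t : R), Theta x -> Theta y -> x != y ->
    0 < t -> t < 1 ->
    g (t *: x + (1 - t) *: y) < t * g x + (1 - t) * g y.

Definition bregman_generator (R : realType) (d : nat) (lambda : R)
    (phi : 'cV[R]_d -> R) (x : 'cV[R]_d) : R :=
  lambda^-1 * (expR (lambda * phi x) - 1).

Definition regular_clambda_convex (R : realType) (d : nat) (lambda : R)
    (Theta : set 'cV[R]_d) (phi : 'cV[R]_d -> R) : Prop :=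
  [/\ smooth Theta phi,
      convex_function Theta (bregman_generator lambda phi),
      forall x, Theta x -> posdefmx (hessian (bregman_generator lambda phi) x)
    & forall x, Theta x -> 0 < 1 - lambda * inner (grad phi x) x].

Definition Gmetric (R : realType) (d : nat) (lambda : R)
    (phi : 'cV[R]_d -> R) (x : 'cV[R]_d) : 'M[R]_d :=
  hessian phi x + lambda *: (grad phi x *m (grad phi x)^T).

Definition bregman (R : realType) (d : nat) (psi : 'cV[R]_d -> R)
    (x y : 'cV[R]_d) : R :=
  psi x - psi y - inner (grad psi y) (x - y).

(* Derivative at [t >= 0] of a curve on [0, +oo[; one-sided at [t = 0]. *)
Definition has_deriv_ge0 (R : realType) (V : normedModType R) (c : R -> V)
    (t : R) (v : V) : Prop :=
  h^-1 *: (c (t + h) - c t) @[h --> within [set h | 0 <= t + h] 0^'] --> v.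

Definition gradient_flow (R : realType) (d : nat) (lambda : R)
    (Theta : set 'cV[R]_d) (phi f : 'cV[R]_d -> R) (theta : R -> 'cV[R]_d)
    : Prop :=
  forall t : R, 0 <= t -> Theta (theta t) /\
    has_deriv_ge0 theta t
      (- (invmx (Gmetric lambda phi (theta t)) *m grad f (theta t))).

Definition time_change (R : realType) (d : nat) (lambda : R)
    (phi : 'cV[R]_d -> R) (theta : R -> 'cV[R]_d) (t : R) : R :=
  \int[lebesgue_measure]_(s in `[0, t]) expR (lambda * phi (theta s)).

Definition time_average (R : realType) (d : nat) (lambda : R)
    (phi : 'cV[R]_d -> R) (theta : R -> 'cV[R]_d) (t : R) : 'cV[R]_d :=
  (time_change lambda phi theta t)^-1 *:
  \col_(i < d) \int[lebesgue_measure]_(s in `[0, t])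
                 (theta s i 0 * expR (lambda * phi (theta s))).

Definition minimizer (R : realType) (d : nat) (Theta : set 'cV[R]_d)
    (f : 'cV[R]_d -> R) (x : 'cV[R]_d) : Prop :=
  Theta x /\ forall y, Theta y -> f x <= f y.

(* Main.v *)
Require Import Defs.
From mathcomp Require Import ring lra.

(** Write [Phi] for the Bregman generator and [X] for the trajectory. The metric
    satisfies [exp (lambda phi) G = hessian Phi], so that after the time change
    [tau' = exp (lambda phi)] the flow becomes mirror descent,
    [d (grad Phi (X)) = - grad f (X) d tau]. Consequently the Bregman divergence
    [B = bregman Phi thetastar (X)] satisfies
    [B' = tau' <grad f (X), thetastar - X>] ([bregman_flow]), which convexity
    bounds by [- tau' (f (X) - f thetastar)]. Integrating, and applying Jensen's
    inequality to the mean [hat] of [X] against [d tau], gives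
    [tau (f hat - f thetastar) <= B 0 - B T <= B 0].

    The integration and Jensen's inequality are done in one stroke in
    [mean_gap_le]: the affine minorant of [f] at [hat] turns the claim into the
    monotonicity of one explicit differentiable function, so that of the
    integrals only the fundamental theorem of calculus is used
    ([Rintegral_primitive]). This requires [hat] to belong to [Theta], which is
    the content of [weighted_mean_in].

    For the rate [O(1/t)] it suffices that [tau t >= m t] for some [m > 0].
    Strict convexity makes the sublevel sets of [f] bounded
    ([sublevel_bounded]), and [f] decreases along the flow ([flow_energy_le]), so
    the trajectory has compact closure; [exp (lambda phi)] is then bounded below
    along it ([flow_weight_lower_bound]). *)

Set Implicit Arguments.
Unset Strict Implicit.
Unset Printing Implicit Defensive.

(** * Inner products, gradients and convexity *)

Lemma innerZr (R : realType) (d : nat) a (u v : 'cV[R]_d) :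
  inner u (a *: v) = a * inner u v.
Proof. by rewrite /inner mulr_sumr; apply: eq_bigr => i _; rewrite mxE mulrCA. Qed.

Lemma innerNr (R : realType) (d : nat) (u v : 'cV[R]_d) :
  inner u (- v) = - inner u v.
Proof. by rewrite -scaleN1r innerZr mulN1r. Qed.

Lemma innerC (R : realType) (d : nat) (u v : 'cV[R]_d) : inner u v = inner v u.
Proof. by apply: eq_bigr => i _; rewrite mulrC. Qed.

Lemma derive_inner_grad (R : realType) (d : nat) (g : 'cV[R]_d -> R)
    (x v : 'cV[R]_d) :
  differentiable g x -> 'D_v g x = inner (grad g x) v.
Proof.
move=> dg; rewrite deriveE//.
have {1}-> : v = \sum_i v i 0 *: delta_mx i 0.
  rewrite [LHS]matrix_sum_delta; apply: eq_bigr => i _.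
  by rewrite big_ord1.
rewrite linear_sum; apply: eq_bigr => i _.
by rewrite linearZ /= mxE /pderiv deriveE// mulrC.
Qed.

Lemma is_derive_comp_grad (R : realType) (d : nat) (g : 'cV[R]_d -> R)
    (c : R -> 'cV[R]_d) (t : R) (v : 'cV[R]_d) :
  differentiable g (c t) -> is_derive t 1 c v ->
  is_derive t 1 (fun s => g (c s)) (inner (grad g (c t)) v).
Proof.
move=> dg [/derivable1_diffP dc dcv].
have dgc : differentiable (g \o c) t by exact: differentiable_comp.
apply: DeriveDef; first exact/derivable1_diffP.
rewrite deriveE//; change ('d (g \o c) t 1 = inner (grad g (c t)) v).
have dc1 : 'd c t (1 : R) = v by rewrite -deriveE.
by rewrite diff_comp//= dc1 -deriveE// derive_inner_grad.
Qed.

Lemma convex_setP (R : realType) (d : nat) (Theta : set 'cV[R]_d) x y (t : R) :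
  convex_set Theta -> Theta x -> Theta y -> 0 <= t -> t <= 1 ->
  Theta (t *: x + (1 - t) *: y).
Proof.
move=> cT Tx Ty t0 t1.
by have := cT x y (Itv01 t0 t1); rewrite !inE; apply.
Qed.

Lemma convex_functionP (R : realType) (d : nat) (Theta : set 'cV[R]_d)
    (g : 'cV[R]_d -> R) x y (t : R) :
  convex_function Theta g -> Theta x -> Theta y -> 0 <= t -> t <= 1 ->
  g (t *: x + (1 - t) *: y) <= t * g x + (1 - t) * g y.
Proof.
move=> cg Tx Ty t0 t1.
by have := cg (Itv01 t0 t1) x y; rewrite !inE; apply.
Qed.

(** Convexity bounds the difference quotients along [x - y] by [g x - g y], and
    the directional derivative is their limit from the right. *)
Lemma convex_gradient_le (R : realType) (d : nat) (Theta : set 'cV[R]_d)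
    (g : 'cV[R]_d -> R) (x y : 'cV[R]_d) :
  convex_function Theta g -> Theta x -> Theta y -> differentiable g y ->
  g y + inner (grad g y) (x - y) <= g x.
Proof.
move=> cg Tx Ty dg.
rewrite -lerBrDl -derive_inner_grad//.
have /cvg_dnbhs_at_right dd : derivable g y (x - y) by exact: diff_derivable.
apply: (cvgr_to_le dd); near=> h.
have h0 : 0 < h by [].
have h1 : h <= 1 by near: h; exact: nbhs_right_le.
rewrite /= -[_ *: _]/(h^-1 * _) mulrC ler_pdivrMr// lerBlDr.
have := convex_functionP cg Tx Ty (ltW h0) h1.
rewrite (_ : h *: x + _ = h *: (x - y) + y); last first.
  by rewrite scalerBr scalerBl scale1r addrA addrAC.
move=> /le_trans; apply; lra.
Unshelve. all: end_near. Qed.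

(** A row vector in the kernel of [A] would, once transposed, annihilate the
    quadratic form of [A]. *)
Lemma posdefmx_unitmx (R : realType) (d : nat) (A : 'M[R]_d) :
  posdefmx A -> A \in unitmx.
Proof.
move=> [AT Apos]; rewrite -row_free_unit -kermx_eq0.
apply: contraT => /rowV0Pn[u /sub_kermxP uA u0].
have : inner u^T (A *m u^T) = 0.
  by rewrite -AT -trmx_mul uA trmx0 -(scale0r 0) innerZr mul0r.
by move=> /eqP; rewrite gt_eqF// Apos// -trmx0 (inj_eq trmx_inj).
Qed.

(** * Induction along an interval *)

(** A form of Cousin's lemma. If [c] is the supremum of the end points [x <= T]
    with [P 0 x], the local hypothesis at [c] joins some such [x] near [c] to
    points past [c], a contradiction unless [c = T]. *)
Lemma interval_induction (R : realType) (P : R -> R -> Prop) (T : R) :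
  (forall a b c : R, 0 <= a -> a < b -> b < c -> P a b -> P b c -> P a c) ->
  (forall c : R, 0 <= c -> exists2 e : R, 0 < e &
     forall a b : R, 0 <= a -> a < b -> c - e < a -> b < c + e -> P a b) ->
  0 < T -> P 0 T.
Proof.
move=> Pcat Ploc T0.
pose S := [set x | [/\ 0 < x, x <= T & P 0 x]].
have S0 : S !=set0.
  have [e e0 Pe] := Ploc 0 (lexx _).
  exists (Num.min T (e / 2)).
  have m0 : 0 < Num.min T (e / 2) by rewrite lt_min T0 divr_gt0.
  have mT : Num.min T (e / 2) <= T by rewrite ge_min lexx.
  have me : Num.min T (e / 2) <= e / 2 by rewrite ge_min lexx orbT.
  by split => //; apply: Pe => //; lra.
have Sub : ubound S T by move=> x [].
have supS : has_sup S by split => //; exists T.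
have cT : sup S <= T by apply: ge_sup.
have [x0 [x0_gt0 x0T Px0]] := S0.
have c0 : 0 < sup S.
  by apply: (lt_le_trans x0_gt0); apply: ub_le_sup => //; exists T.
have [e e0 Pe] := Ploc _ (ltW c0).
have [x [x_gt0 xT Px] xc] := sup_adherent e0 supS.
have xs : x <= sup S by apply: ub_le_sup => //; exists T.
set y := Num.min T (sup S + e / 2).
have yT : y <= T by rewrite ge_min lexx.
have ye : y <= sup S + e / 2 by rewrite ge_min lexx orbT.
have [xy|yx] := ltP x y.
  have Py : P 0 y by apply: (Pcat _ x) => //; apply: Pe => //; lra.
  have : y <= sup S.
    by apply: ub_le_sup; [exists T|split => //; lra].
  move=> yS; suff -> : T = y by [].
  have [Ts|sT] := leP T (sup S + e / 2); first by rewrite /y min_l.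
  by move: yS; rewrite /y (min_r (ltW sT)); lra.
suff -> : T = x by [].
apply/eqP; rewrite eq_le xT andbT.
by move: yx; rewrite /y ge_min => /orP[//|]; lra.
Qed.

(** * Calculus on the half-line *)

(** The primitive is based at -1, so that 0 is an interior point of its domain
    and the fundamental theorem of calculus gives a two-sided derivative
    there too. *)
Lemma Rintegral_primitive (R : realType) (g : R -> R) :
  continuous g ->
  exists F : R -> R,
    (forall x : R, 0 <= x -> F x = \int[lebesgue_measure]_(s in `[0, x]) g s) /\
    (forall x : R, 0 <= x -> is_derive x 1 F (g x)).
Proof.
move=> cg.
have ig (a b : R) : lebesgue_measure.-integrable `[a, b] (EFin \o g).
  apply: continuous_compact_integrable; first exact: segment_compact.
  exact: continuous_subspaceT.
pose G (x : R) : R := \int[lebesgue_measure]_(s in `[-1, x]) g s.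
exists (fun x : R => G x - G 0); split => x x0.
  rewrite /G Rintegral_itvB ?bnd_simp//.
  rewrite Rintegral_itv_obnd_cbnd//; apply: integrableS (ig 0 x) => //.
  exact: subset_itv_oc_cc.
have x1 : x < x + 1 by rewrite ltrDl.
have x_gt : -1 < x by apply: lt_le_trans x0; rewrite ltrN10.
have [dG G'] := continuous_FTC1_closed x1 (ig _ _) x_gt (cg x).
have dG' : is_derive x 1 G (g x) by apply: DeriveDef; rewrite -?derive1E.
rewrite -[X in is_derive _ _ X _]/(G - cst (G 0)).
by apply: is_derive_eq; rewrite subr0.
Qed.

(** Only the values of [c] on the half-line enter its one-sided derivative, so
    any two-sided differentiable extension [F] computes it. *)
Lemma is_derive_has_deriv_ge0 (R : realType) (V : normedModType R)
    (c F : R -> V) (t : R) (v : V) :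
  (forall s : R, 0 <= s -> c s = F s) -> 0 <= t -> is_derive t 1 F v ->
  has_deriv_ge0 c t v.
Proof.
move=> cF t0 [dF <-]; rewrite /has_deriv_ge0.
have /= dd : h^-1 *: ((F \o shift t) (h *: 1) - F t) @[h --> 0^'] --> 'D_1 F t.
  exact: dF.
have dw : h^-1 *: ((F \o shift t) (h *: 1) - F t)
    @[h --> within [set h | 0 <= t + h] 0^'] --> 'D_1 F t.
  exact: cvg_within_filter dd.
apply: cvg_trans dw; apply: near_eq_cvg.
rewrite near_withinE; near=> h => /= th.
by rewrite !cF// [_%:A]mulr1 [h + t]addrC.
Unshelve. all: end_near. Qed.

Lemma has_deriv_ge0_is_derive (R : realType) (V : normedModType R)
    (c : R -> V) (t : R) (v : V) :
  0 < t -> has_deriv_ge0 c t v -> is_derive t 1 c v.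
Proof.
move=> t0 ct.
have cv : h^-1 *: ((c \o shift t) (h *: 1) - c t) @[h --> 0^'] --> v.
  apply: cvg_trans ct.
  move=> A wA.
  have {}wA : \forall h \near (0 : R)^', 0 <= t + h ->
    A (h^-1 *: (c (t + h) - c t)) by exact: wA.
  have tn : \forall h \near (0:R)^', 0 <= t + h.
    have := @dnbhs0_lt R R t t0; apply: filterS => h /=.
    by rewrite ltr_norml => /andP[]; lra.
  suff : \forall h \near (0 : R)^', A (h^-1 *: ((c \o shift t) (h *: 1) - c t)).
    by [].
  near=> h => /=; rewrite [_%:A]mulr1 [h + t]addrC.
  have th : 0 <= t + h by near: h.
  by move: th; near: h.
apply: DeriveDef; first by apply/cvg_ex; exists v.
exact/cvg_lim.
Unshelve. all: end_near. Qed.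

(** The one-sided difference quotients give continuity of [c] within the
    half-line, which passes to the extension frozen for negative times because
    [Num.max _ 0] is 1-Lipschitz. *)
Lemma has_deriv_ge0_continuous (R : realType) (V : normedModType R)
    (c : R -> V) (dc : R -> V) :
  (forall t : R, 0 <= t -> has_deriv_ge0 c t (dc t)) ->
  continuous (fun s : R => c (Num.max s 0)).
Proof.
move=> cdc s; set t := Num.max s 0.
have t0 : 0 <= t by rewrite le_max lexx orbT.
have ct : c (t + h) @[h --> within [set h | 0 <= t + h] 0^'] --> c t.
  have h0 : (h : R) @[h --> within [set h | 0 <= t + h] 0^'] --> (0 : R).
    by apply: cvg_within_filter; apply: cvg_within.
  have cl : c t + h *: (h^-1 *: (c (t + h) - c t))
      @[h --> within [set h | 0 <= t + h] 0^'] --> c t.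
    rewrite -[X in _ --> X]addr0 -[X in _ --> _ + X](scale0r (dc t)).
    by apply: cvgD; [exact: cvg_cst|apply: cvgZ; [exact: h0|exact: cdc]].
  apply: cvg_trans cl; apply: near_eq_cvg.
  rewrite near_withinE; near=> h => _ /=.
  have h_neq0 : h != 0 by near: h; exact: nbhs_dnbhs_neq.
  by rewrite scalerA divff// scale1r addrC subrK.
apply/cvgrPdist_lt => e e0.
have /cvgrPdist_lt/(_ e e0) := ct.
rewrite /within /= !near_simpl => /nbhs_ballP[r /= r0 rP].
apply/nbhs_ballP; exists r => //= u su; set w := Num.max u 0.
have w0 : 0 <= w by rewrite le_max lexx orbT.
have tw : `|t - w| <= `|s - u|.
  rewrite /t /w; case: (leP s 0); case: (leP u 0) => *; rewrite ?subrr ?normr0//.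
  - by rewrite sub0r normrN [leRHS]distrC ger0_norm ?ger0_norm; lra.
  - by rewrite subr0 ger0_norm ?ger0_norm; lra.
have [->|wt] := eqVneq w t; first by rewrite subrr normr0.
have := rP (w - t); rewrite /= [t + _]addrC subrK; apply => //.
- by rewrite /ball /= sub0r normrN distrC (le_lt_trans tw).
- by rewrite subr_eq0.
Unshelve. all: end_near. Qed.

(** * Weighted means of curves in an open convex set *)

Lemma derive_le0_nonincreasing (R : realType) (H dH : R -> R) (a b : R) :
  a <= b -> {within `[a, b], continuous H} ->
  (forall s : R, a < s -> s < b -> is_derive s 1 H (dH s)) ->
  (forall s : R, a < s -> s < b -> dH s <= 0) -> H b <= H a.
Proof.
move=> ab cH dHE dH0.
apply: (@ler0_derive1_le_cc R H a b) => //.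
- move=> s; rewrite in_itv /= => /andP[sa sb].
  exact: (@ex_derive _ _ _ _ _ _ _ (dHE s sa sb)).
- move=> s; rewrite in_itv /= => /andP[sa sb].
  by rewrite derive1E (@derive_val _ _ _ _ _ _ _ (dHE s sa sb)) dH0.
- by rewrite in_itv /= lexx ab.
- by rewrite in_itv /= lexx ab.
Qed.

(** By the Cauchy mean value theorem, each coordinate of the [w]-mean of [X] over
    a short interval is a value of the same coordinate of [X] nearby. Balls are
    cubes (the norm is the sup norm), so such a mean lies in a ball contained in
    [Theta]. The mean over the union of two adjacent intervals is a convex
    combination of the two means, and [interval_induction] passes to the whole
    of [[0, T]]. The integrals are represented by primitives, [W] of [w] and
    [M i] of [X_i w], because only mean value theorems are applied to them. *)
Lemma weighted_mean_in (R : realType) (d : nat) (Theta : set 'cV[R]_d)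
    (X : R -> 'cV[R]_d) (W w : R -> R) (M : 'I_d -> R -> R) (T : R) :
  open Theta -> convex_set Theta -> continuous X ->
  (forall s : R, 0 <= s -> Theta (X s)) ->
  (forall s : R, 0 <= s -> 0 < w s) ->
  (forall s : R, 0 <= s -> is_derive s 1 W (w s)) ->
  (forall i (s : R), 0 <= s -> is_derive s 1 (M i) (X s i 0 * w s)) ->
  0 < T -> W 0 = 0 -> (forall i, M i 0 = 0) ->
  Theta ((W T)^-1 *: \col_i M i T).
Proof.
move=> oT cT cX TX w0 dW dM T0 W0 M0.
have cnt (F dF : R -> R) : (forall s : R, 0 <= s -> is_derive s 1 F (dF s)) ->
    forall a b : R, 0 <= a -> {within `[a, b], continuous F}.
  move=> FdF a b a0; apply: derivable_within_continuous => s.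
  rewrite in_itv /= => /andP[sa _].
  exact: (@ex_derive _ _ _ _ _ _ _ (FdF s (le_trans a0 sa))).
have Wlt (a b : R) : 0 <= a -> a < b -> 0 < W b - W a.
  move=> a0 ab.
  have dWab x : x \in `]a, b[ -> is_derive x 1 W (w x).
    by rewrite in_itv /= => /andP[xa _]; apply: dW; lra.
  have [x] := MVT ab dWab (cnt _ _ dW a b a0).
  rewrite in_itv /= => /andP[xa _] ->.
  by rewrite mulr_gt0 ?subr_gt0// w0//; lra.
pose mean a b := (W b - W a)^-1 *: \col_i (M i b - M i a).
suff : Theta (mean 0 T).
  rewrite /mean W0 subr0; congr (Theta (_ *: _)).
  by apply/colP => i; rewrite !mxE M0 subr0.
apply: (@interval_induction R (fun a b => Theta (mean a b))) T0.
  move=> a b c a0 ab bc Tab Tbc.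
  have b0 : 0 <= b by lra.
  have Wab := Wlt a b a0 ab; have Wbc := Wlt b c b0 bc.
  have Wac : 0 < W c - W a by lra.
  (* the weight of each half is its share of the total mass of [w] *)
  have -> : mean a c = ((W b - W a) / (W c - W a)) *: mean a b +
                       (1 - (W b - W a) / (W c - W a)) *: mean b c.
    apply/colP => i; rewrite !mxE; field.
    by rewrite !gt_eqF.
  apply: convex_setP => //.
    by rewrite divr_ge0// ltW.
  by rewrite ler_pdivrMr// mul1r; lra.
move=> c c0.
have /nbhs_ballP[r /= r0 rT] : nbhs (X c) Theta.
  by apply: open_nbhs_nbhs; split => //; apply: TX.
have /nbhs_ballP[e /= e0 eX] := cX c _ (nbhsx_ballx (X c) r r0).
exists e => // a b a0 ab ca bc; apply: rT; split => // i j.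
rewrite ord1.
have [|||||x] := @cauchy_MVT R (M i) (fun s => X s i 0 * w s) W w a b ab.
- exact: (cnt _ _ (dM i)).
- exact: (cnt _ _ dW).
- by move=> x; rewrite in_itv /= => /andP[xa _]; apply: dM; lra.
- by move=> x; rewrite in_itv /= => /andP[xa _]; apply: dW; lra.
- by move=> x; rewrite in_itv /= => /andP[xa _]; rewrite gt_eqF// w0//; lra.
rewrite in_itv /= => /andP[xa xb].
have wx : 0 < w x by apply: w0; lra.
rewrite mulfK ?gt_eqF// => Xx.
rewrite !mxE [X in ball _ _ X]mulrC -Xx.
have [//|_ H] := eX x _; last exact: H.
by rewrite /ball /= ltr_norml; apply/andP; split; lra.
Qed.

(** * Calculus of the Bregman generator *)

Lemma is_derive_expR_comp (R : realType) (V : normedModType R) (lambda : R)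
    (g : V -> R) (x v : V) :
  differentiable g x ->
  differentiable (fun y => expR (lambda * g y)) x /\
  is_derive x v (fun y => expR (lambda * g y))
    (expR (lambda * g x) * (lambda * 'D_v g x)).
Proof.
move=> dg.
have dlg : differentiable (lambda *: g) x by exact: differentiableZ.
have de : differentiable (expR : R -> R) ((lambda *: g) x).
  exact/derivable1_diffP/derivable_expR.
have dc : differentiable (expR \o (lambda *: g)) x.
  exact: differentiable_comp.
split; first exact: dc.
have dv : derivable (expR \o (lambda *: g)) x v by exact: diff_derivable.
apply: (@DeriveDef _ _ _ x v (expR \o (lambda *: g)) _ dv).
rewrite deriveE// diff_comp// [LHS]/= diff1E// derive1E derive_val diffZ//= deriveE//.
by rewrite mulrC.
Qed.

Lemma pderiv_near_eq (R : realType) (d : nat) (Theta : set 'cV[R]_d)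
    (g h : 'cV[R]_d -> R) x i :
  open Theta -> Theta x -> (forall y, Theta y -> g y = h y) ->
  pderiv i g x = pderiv i h x.
Proof.
move=> oT Tx gh; apply: near_eq_derive.
by apply: (filterS gh); apply: open_nbhs_nbhs.
Qed.

Lemma is_derive_bregman_generator (R : realType) (d : nat) (lambda : R)
    (phi : 'cV[R]_d -> R) (x v : 'cV[R]_d) :
  lambda != 0 -> differentiable phi x ->
  is_derive x v (bregman_generator lambda phi)
    (expR (lambda * phi x) * 'D_v phi x).
Proof.
move=> l0 dphi; have [_ de] := is_derive_expR_comp lambda v dphi.
have -> : bregman_generator lambda phi =
  lambda^-1 *: ((fun y => expR (lambda * phi y)) - cst 1) by [].
apply: is_derive_eq; rewrite subr0 -[_ *: _]/(_ * _).
by rewrite mulrCA mulKf.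
Qed.

Lemma differentiable_bregman_generator (R : realType) (d : nat) (lambda : R)
    (phi : 'cV[R]_d -> R) (x : 'cV[R]_d) :
  differentiable phi x -> differentiable (bregman_generator lambda phi) x.
Proof.
move=> dphi; have [de _] := is_derive_expR_comp lambda 0 dphi.
have -> : bregman_generator lambda phi =
  lambda^-1 *: ((fun y => expR (lambda * phi y)) - cst 1) by [].
by apply: differentiableZ; apply: differentiableB.
Qed.

Lemma grad_bregman_generator (R : realType) (d : nat) (lambda : R)
    (phi : 'cV[R]_d -> R) (x : 'cV[R]_d) :
  lambda != 0 -> differentiable phi x ->
  grad (bregman_generator lambda phi) x = expR (lambda * phi x) *: grad phi x.
Proof.
move=> l0 dphi; apply/colP => i; rewrite !mxE /pderiv.
exact: (@derive_val _ _ _ _ _ _ _ (is_derive_bregman_generator _ l0 dphi)).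
Qed.

Lemma is_derive_expR_pderiv (R : realType) (d : nat) (lambda : R)
    (phi : 'cV[R]_d -> R) (x v : 'cV[R]_d) (i : 'I_d) :
  differentiable phi x -> differentiable (pderiv i phi) x ->
  differentiable (fun y => expR (lambda * phi y) * pderiv i phi y) x /\
  'D_v (fun y => expR (lambda * phi y) * pderiv i phi y) x =
  expR (lambda * phi x) *
    ('D_v (pderiv i phi) x + lambda * pderiv i phi x * 'D_v phi x).
Proof.
move=> dphi dphi'; have [de [ve dv]] := is_derive_expR_comp lambda v dphi.
split; first exact: differentiableM.
have -> : (fun y => expR (lambda * phi y) * pderiv i phi y) =
  (fun y => expR (lambda * phi y)) * pderiv i phi by [].
rewrite deriveM ?dv//; last exact: diff_derivable.
rewrite -![_ *: _]/(_ * _); ring.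
Qed.

(** Directional form of the metric: row [i] of [G v] is the derivative along
    [v] of the [i]-th component of [grad phi], plus the rank-one term. *)
Lemma Gmetric_mulE (R : realType) (d : nat) (lambda : R)
    (phi : 'cV[R]_d -> R) (x v : 'cV[R]_d) (i : 'I_d) :
  differentiable phi x -> differentiable (pderiv i phi) x ->
  (Gmetric lambda phi x *m v) i 0 =
  'D_v (pderiv i phi) x + lambda * pderiv i phi x * 'D_v phi x.
Proof.
move=> dphi dphi'; rewrite !derive_inner_grad// /Gmetric mulmxDl mxE; congr (_ + _).
  by rewrite mxE; apply: eq_bigr => j _; rewrite !mxE.
rewrite -scalemxAl -mulmxA mxE [X in lambda * X]mxE big_ord1 mulrA.
congr (_ * _); first by rewrite mxE.
by rewrite mxE; apply: eq_bigr => j _; rewrite !mxE.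
Qed.

(** The metric is conformal to the Hessian metric of the Bregman generator; this
    is how positive definiteness reaches [Gmetric]. *)
Lemma hessian_bregman_generator (R : realType) (d : nat) (lambda : R)
    (Theta : set 'cV[R]_d) (phi : 'cV[R]_d -> R) (x : 'cV[R]_d) :
  lambda != 0 -> open Theta -> Ck 2 Theta phi -> Theta x ->
  hessian (bregman_generator lambda phi) x =
  expR (lambda * phi x) *: Gmetric lambda phi x.
Proof.
move=> l0 oT [dphi dphi'] Tx; apply/matrixP => i j; rewrite mxE.
rewrite (pderiv_near_eq (h := fun y => expR (lambda * phi y) * pderiv i phi y)
  j oT Tx); last first.
  move=> y /dphi dy.
  exact: (@derive_val _ _ _ _ _ _ _ (is_derive_bregman_generator _ l0 dy)).
have di := (dphi' i).1 x Tx.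
rewrite /pderiv (is_derive_expR_pderiv lambda _ (dphi x Tx) di).2.
rewrite -Gmetric_mulE// ?mxE; last exact: dphi.
congr (_ * _).
rewrite (bigD1 j)//= big1 ?addr0 => [|k kj].
  by rewrite [delta_mx _ _ _ _]mxE !eqxx mulr1 !mxE.
by rewrite [delta_mx _ _ _ _]mxE (negbTE kj) mulr0.
Qed.

Lemma is_derive_coord (R : realType) (d : nat) (x v : 'cV[R]_d) i :
  is_derive x v (fun y : 'cV[R]_d => y i 0) (v i 0).
Proof.
apply: DeriveDef; first exact/diff_derivable/differentiable_coord.
have := derive_mx (@derivable_id _ _ x v); rewrite derive_id.
by move/matrixP => /(_ i 0); rewrite mxE => <-.
Qed.

(** The gradient of the generator is replaced by its closed form, which has the
    advantage of being visibly differentiable in [x]. *)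
Lemma bregman_generatorE (R : realType) (d : nat) (lambda : R)
    (phi : 'cV[R]_d -> R) (x z : 'cV[R]_d) :
  lambda != 0 -> differentiable phi x ->
  bregman (bregman_generator lambda phi) z x =
  bregman_generator lambda phi z - bregman_generator lambda phi x -
  \sum_i (expR (lambda * phi x) * pderiv i phi x) * (z i 0 - x i 0).
Proof.
move=> l0 dphi; rewrite /bregman grad_bregman_generator//; congr (_ - _).
by apply: eq_bigr => i _; rewrite !mxE.
Qed.

(** Differentiating a Bregman divergence in its second argument, the first-order
    terms cancel and only the Hessian of the generator, that is [exp (lambda
    phi) G], is left, paired with [z - x]. *)
Lemma derive_bregman_generator (R : realType) (d : nat) (lambda : R)
    (phi : 'cV[R]_d -> R) (x z v : 'cV[R]_d)
  (B := fun y => bregman_generator lambda phi z - bregman_generator lambda phi y -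
    \sum_i (expR (lambda * phi y) * pderiv i phi y) * (z i 0 - y i 0)) :
  lambda != 0 -> differentiable phi x ->
  (forall i, differentiable (pderiv i phi) x) ->
  differentiable B x /\
  'D_v B x = - expR (lambda * phi x) * inner (Gmetric lambda phi x *m v) (z - x).
Proof.
move=> l0 dphi dphi'.
pose m i y := expR (lambda * phi y) * pderiv i phi y.
pose u i (y : 'cV[R]_d) : R := z i 0 - y i 0.
have BE : B = (cst (bregman_generator lambda phi z) -
   bregman_generator lambda phi) - \sum_i (m i * u i).
  by apply/funext => y; rewrite /B [RHS]/GRing.add /= [in RHS]/GRing.opp /= fct_sumE.
have dm i := is_derive_expR_pderiv lambda v dphi (dphi' i).
have du i : differentiable (u i) x.
  apply: differentiableB; first exact: differentiable_cst.
  exact: differentiable_coord.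
have dmu i : differentiable (m i * u i) x.
  by apply: differentiableM => //; exact: (dm i).1.
have dgen := differentiable_bregman_generator lambda dphi.
have dB : differentiable B x.
  rewrite BE; apply: differentiableB; last exact: differentiable_sum.
  by apply: differentiableB => //; exact: differentiable_cst.
split => //.
have ddm i : is_derive x v (m i)
    (expR (lambda * phi x) * (Gmetric lambda phi x *m v) i 0).
  rewrite Gmetric_mulE//; apply: DeriveDef; last exact: (dm i).2.
  exact: (diff_derivable (dm i).1).
have ddu i : is_derive x v (u i) (- v i 0).
  have := is_derive_coord x v i => dci.
  rewrite -[u i]/(cst (z i 0) - (fun y : 'cV[R]_d => y i 0)).
  by apply: is_derive_eq; rewrite sub0r.
have dg := is_derive_bregman_generator v l0 dphi.
rewrite BE derive_val sub0r.
have -> : expR (lambda * phi x) * 'D_v phi x = \sum_i m i x * v i 0.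
  rewrite derive_inner_grad// mulr_sumr; apply: eq_bigr => i _.
  by rewrite mxE mulrA.
rewrite /inner mulr_sumr -!sumrN -big_split/=; apply: eq_bigr => i _.
by rewrite -![_ *: _]/(_ * _) /u !mxE; ring.
Qed.

(** * Bounded sublevel sets *)

(** Heine-Borel for column vectors, transported from row vectors by the
    transposition, which is an isometry. *)
Lemma cV_bounded_closed_compact (R : realType) (d : nat) (A : set 'cV[R]_d) :
  bounded_set A -> closed A -> compact A.
Proof.
have ctr m n : continuous (@trmx R m n).
  move=> x B /nbhs_ballP[e /= e0 eB].
  apply/nbhs_ballP; exists e => // y [_ xy]; apply: eB; split => // i j.
  by rewrite !mxE; exact: xy.
have ntr m n (x : 'M[R]_(m, n)) : `|x^T| <= `|x|.
  rewrite {1}/Num.norm /= mx_normrE; apply: bigmax_le => // -[i j] _ /=.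
  rewrite mxE [leRHS]/Num.norm /= mx_normrE.
  by apply/bigmax_geP; right => /=; exists (j, i).
move=> bA cA.
have -> : A = trmx @` (trmx @^-1` A).
  rewrite eqEsubset; split => [x Ax|_ [y Ay <-]//].
  by exists x^T; rewrite /= trmxK.
apply: continuous_compact; first exact/continuous_subspaceT/ctr.
apply: bounded_closed_compact; last by move/continuous_closedP : (@ctr 1%N d); exact.
move: bA => [M [Mr MA]]; exists M; split => // N MN x /= Ax.
by rewrite -[x]trmxK (le_trans (ntr _ _ _))// MA.
Qed.

(** Strict convexity makes [f] exceed its minimum by some [m > 0] on a small
    sphere around the minimizer, by compactness. By convexity along rays, the
    excess of [f] then grows at least linearly with the distance. *)
Lemma sublevel_bounded (R : realType) (d : nat) (Theta : set 'cV[R]_d)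
    (f : 'cV[R]_d -> R) (z : 'cV[R]_d) (c : R) :
  open Theta -> convex_set Theta -> (forall x, Theta x -> {for x, continuous f}) ->
  strictly_convex Theta f -> minimizer Theta f z ->
  exists M : R, forall x, Theta x -> f x <= c -> `|x - z| <= M.
Proof.
move=> oT cT ctf scf [Tz fz].
have /nbhs_ballP[e /= e0 eT] : nbhs z Theta by apply: open_nbhs_nbhs.
pose r := e / 2; have r0 : 0 < r by rewrite divr_gt0.
pose S := [set y : 'cV[R]_d | `|y - z| = r].
have ST : S `<=` Theta.
  move=> y Sy; apply: eT; rewrite -ball_normE /= distrC Sy /r; lra.
have cS : compact S.
  apply: cV_bounded_closed_compact.
    exists (r + `|z|); split; first exact: num_real.
    move=> N rN y /= Sy; rewrite -(subrK z y) (le_trans (ler_normD _ _))//.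
    by rewrite Sy ltW.
  rewrite -[S]/((Num.norm \o (fun y => y - z)) @^-1` [set r]).
  apply: (preimage_closed _ (@closed_eq _ _)) => y _.
  apply: (continuous_comp _ (@norm_continuous _ _ _)).
  apply: continuousB; last exact: cst_continuous.
  by move=> A.
have Smin : exists2 m : R, 0 < m & forall y, S y -> f z + m <= f y.
  (* the sphere is empty when the dimension is 0 *)
  have [S0|/forallNP S0] := pselect (S !=set0); last first.
    by exists 1 => // y /S0.
  have [|k kS kmin] := compact_EVT_min S0 cS (f := f).
    by apply: continuous_in_subspaceT => y; rewrite inE => /ST /ctf.
  have Sk : S k by rewrite inE in kS.
  have zk : k != z.
    by apply/eqP => kz; move: Sk; rewrite /S /= kz subrr normr0 => /eqP; rewrite lt_eqF.
  (* the midpoint of [k] and [z] still has value at least [f z] *)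
  exists (f k - f z).
    have h0 : (0 : R) < 2^-1 by rewrite invr_gt0.
    have h1 : (2^-1 : R) < 1 by lra.
    have := scf _ _ _ (ST _ Sk) Tz zk h0 h1.
    have := fz _ (convex_setP cT (ST _ Sk) Tz (ltW h0) (ltW h1)).
    lra.
  move=> y Sy; have := kmin y; rewrite inE => /(_ Sy); lra.
have [m m0 mS] := Smin.
exists (Num.max r (r * (c - f z) / m)) => x Tx fxc.
have [xr|rx] := leP `|x - z| r; first by rewrite le_max xr.
rewrite le_max; apply/orP; right.
have x0 : 0 < `|x - z| by apply: lt_trans rx.
(* [x] outside the ball is pulled back to the sphere along the ray from [z] *)
pose t := r / `|x - z|.
have t0 : 0 < t by rewrite divr_gt0.
have t1 : t < 1 by rewrite ltr_pdivrMr// mul1r.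
have xz : x != z by rewrite -subr_eq0 -normr_gt0.
have Sy : S (t *: x + (1 - t) *: z).
  rewrite /S /= (_ : _ - z = t *: (x - z)).
    by rewrite normrZ gtr0_norm// /t divfK// gt_eqF.
  by rewrite scalerBr scalerBl scale1r [z - _]addrC addrA addrK.
have := scf _ _ _ Tx Tz xz t0 t1.
have := mS _ Sy => h1 h2.
have : m <= t * (c - f z).
  have : t * f x <= t * c by rewrite ler_pM2l.
  lra.
rewrite /t mulrAC ler_pdivlMr// => h3.
by rewrite ler_pdivlMr// mulrC.
Qed.

(** * The gradient flow *)

(** Freezing the curve at its initial value for negative times gives a curve
    continuous on all of R, so that primitives of functions along it are
    differentiable at 0 from both sides. *)
Lemma gradient_flow_extend (R : realType) (d : nat) (lambda : R)
    (Theta : set 'cV[R]_d) (phi f : 'cV[R]_d -> R) (theta : R -> 'cV[R]_d)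
    (X := fun s : R => theta (Num.max s 0)) :
  gradient_flow lambda Theta phi f theta ->
  [/\ continuous X, forall s : R, Theta (X s),
      forall s : R, 0 <= s -> X s = theta s &
      forall s : R, 0 < s -> is_derive s 1 X
        (- (invmx (Gmetric lambda phi (X s)) *m grad f (X s)))].
Proof.
move=> flow.
have XE (s : R) : 0 <= s -> X s = theta s by move=> s0; rewrite /X max_l.
split => //.
- by apply: has_deriv_ge0_continuous => t t0; exact: (flow t t0).2.
- by move=> s; apply: (flow _ _).1; rewrite le_max lexx orbT.
move=> s s0; rewrite XE ?ltW//.
have := has_deriv_ge0_is_derive s0 (flow s (ltW s0)).2.
apply: near_eq_is_derive; near=> u; rewrite XE// ltW//.
by near: u; exact: lt_nbhsr.
Unshelve. all: end_near. Qed.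

Lemma Gmetric_unitmx (R : realType) (d : nat) (lambda : R)
    (Theta : set 'cV[R]_d) (phi : 'cV[R]_d -> R) (x : 'cV[R]_d) :
  lambda != 0 -> open Theta -> regular_clambda_convex lambda Theta phi ->
  Theta x -> Gmetric lambda phi x \in unitmx.
Proof.
move=> l0 oT [sphi _ pos _] Tx; have := posdefmx_unitmx (pos x Tx).
rewrite (hessian_bregman_generator l0 oT (sphi 2%N) Tx).
by rewrite unitmxZ// unitfE gt_eqF// expR_gt0.
Qed.

Lemma Gmetric_ge0 (R : realType) (d : nat) (lambda : R)
    (Theta : set 'cV[R]_d) (phi : 'cV[R]_d -> R) (x v : 'cV[R]_d) :
  lambda != 0 -> open Theta -> regular_clambda_convex lambda Theta phi ->
  Theta x -> 0 <= inner v (Gmetric lambda phi x *m v).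
Proof.
move=> l0 oT [sphi _ pos _] Tx.
have [->|v0] := eqVneq v 0.
  by rewrite /inner big1// => i _; rewrite mxE mul0r.
have := (pos x Tx).2 v v0.
rewrite (hessian_bregman_generator l0 oT (sphi 2%N) Tx) -scalemxAl innerZr.
by rewrite pmulr_rgt0 ?expR_gt0// => /ltW.
Qed.

(** Substituting the velocity [- G^-1 g] in [derive_bregman_generator], the
    metric cancels: in the time [tau], with [tau' = exp (lambda phi)], the
    divergence evolves as under the mirror descent generated by [g]. *)
Lemma bregman_flow (R : realType) (d : nat) (lambda : R)
    (Theta : set 'cV[R]_d) (phi : 'cV[R]_d -> R) (X : R -> 'cV[R]_d)
    (z : 'cV[R]_d) (B := fun s => bregman (bregman_generator lambda phi) z (X s)) :
  lambda != 0 -> open Theta -> regular_clambda_convex lambda Theta phi ->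
  continuous X -> (forall s, Theta (X s)) ->
  continuous B /\
  forall (s : R) g, is_derive s 1 X (- (invmx (Gmetric lambda phi (X s)) *m g)) ->
    is_derive s 1 B (expR (lambda * phi (X s)) * inner g (z - X s)).
Proof.
move=> l0 oT reg cX TX; have [sphi _ _ _] := reg.
have dphi x : Theta x -> differentiable phi x by exact: (sphi 1%N).1.
have dphi' i x : Theta x -> differentiable (pderiv i phi) x.
  exact: ((sphi 2%N).2 i).1.
pose F y := bregman_generator lambda phi z - bregman_generator lambda phi y -
    \sum_i (expR (lambda * phi y) * pderiv i phi y) * (z i 0 - y i 0).
have BE : B = (fun s => F (X s)).
  by apply/funext => s; rewrite /B bregman_generatorE//; exact: dphi.
have dF s v := derive_bregman_generator z v l0 (dphi _ (TX s))
  (fun i => dphi' i _ (TX s)).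
rewrite BE; split => [s|s g dX].
  apply: continuous_comp; first exact: cX.
  exact: differentiable_continuous (dF s 0).1.
set v := - _ in dX.
have [dFs dFv] := dF s v.
have := is_derive_comp_grad dFs dX.
rewrite -derive_inner_grad// dFv /v mulmxN mulmxA mulmxV; last first.
  exact: Gmetric_unitmx reg _.
by rewrite mul1mx innerC innerNr innerC mulrNN.
Qed.

(** The function [B + L] below has derivative
    [e (<grad f (X), z - X> + f hat - f z + <grad f hat, X - hat>)], with
    [e = exp (lambda phi (X))]. The gradient inequality for [f] at [X] and at
    [hat] shows that this is nonpositive. At time 0 the function equals [B 0];
    at time [T] the linear terms cancel by the choice of [hat], leaving
    [B T + W T (f hat - f z)] with [B T >= 0]. The second use of the gradient
    inequality is Jensen's inequality in differential form. *)
Lemma mean_gap_le (R : realType) (d : nat) (lambda : R)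
    (Theta : set 'cV[R]_d) (phi f : 'cV[R]_d -> R) (X : R -> 'cV[R]_d)
    (W : R -> R) (M : 'I_d -> R -> R) (z : 'cV[R]_d) (T : R)
    (B := fun s => bregman (bregman_generator lambda phi) z (X s))
    (hat := (W T)^-1 *: \col_i M i T) :
  lambda != 0 -> open Theta -> regular_clambda_convex lambda Theta phi ->
  Ck 1 Theta f -> convex_function Theta f -> Theta z ->
  continuous X -> (forall s, Theta (X s)) ->
  (forall s : R, 0 < s -> is_derive s 1 X
     (- (invmx (Gmetric lambda phi (X s)) *m grad f (X s)))) ->
  (forall s : R, 0 <= s -> is_derive s 1 W (expR (lambda * phi (X s)))) ->
  (forall i (s : R), 0 <= s ->
     is_derive s 1 (M i) (X s i 0 * expR (lambda * phi (X s)))) ->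
  W 0 = 0 -> (forall i, M i 0 = 0) -> 0 < T -> 0 < W T ->
  Theta hat -> W T * (f hat - f z) <= B 0.
Proof.
move=> l0 oT reg fC1 cf Tz cX TX dX dW dM W0 M0 T0 WT Th.
have df x : Theta x -> differentiable f x by exact: fC1.1.
have [cB dB] := bregman_flow z l0 oT reg cX TX.
pose g := grad f hat.
pose L : R -> R := (f hat - f z) *: W +
  \sum_i (g i 0 *: M i - (g i 0 * hat i 0) *: W).
have LE s : L s = (f hat - f z) * W s + \sum_i g i 0 * (M i s - hat i 0 * W s).
  rewrite /L [LHS]/GRing.add /= fct_sumE; congr (_ + _).
  apply: eq_bigr => i _; rewrite [LHS]/GRing.add /= /GRing.opp /=.
  by rewrite -![(_ *: _) s]/(_ * _) mulrBr mulrA.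
pose e s := expR (lambda * phi (X s)).
pose dL s := (f hat - f z) *: e s +
  \sum_i (g i 0 *: (X s i 0 * e s) - (g i 0 * hat i 0) *: e s).
have LD (s : R) : 0 <= s -> is_derive s 1 L (dL s).
  move=> s0; have dWs := dW s s0.
  have dMs i := dM i s s0.
  by apply: is_deriveD; apply: is_derive_sum.
pose H := B + L.
have cH : {within `[0, T], continuous H}.
  apply: continuous_in_subspaceT => s; rewrite inE /= in_itv /= => /andP[s0 _].
  apply: continuousD; first exact: cB.
  apply: differentiable_continuous; apply/derivable1_diffP.
  exact: (@ex_derive _ _ _ _ _ _ _ (LD s s0)).
have HD (s : R) : 0 < s ->
    is_derive s 1 H (e s * inner (grad f (X s)) (z - X s) + dL s).
  move=> s0; have dBs := dB s _ (dX s s0).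
  have dLs := LD s (ltW s0).
  exact: is_deriveD.
have : H T <= H 0.
  apply: (@derive_le0_nonincreasing R H _ 0 T (ltW T0) cH (fun s s0 _ => HD s s0)) => s s0 _.
  have -> : dL s = e s * (f hat - f z + inner g (X s - hat)).
    rewrite /dL mulrDr -[_ *: _]/(_ * _) [_ * e s]mulrC; congr (_ + _).
    rewrite /inner mulr_sumr; apply: eq_bigr => i _.
    by rewrite -![_ *: _]/(_ * _) !mxE; ring.
  rewrite -mulrDr pmulr_rle0 ?expR_gt0//.
  have := convex_gradient_le cf Tz (TX s) (df _ (TX s)).
  have := convex_gradient_le cf (TX s) Th (df _ Th).
  rewrite -/g; lra.
rewrite /H -![(B + L) _]/(B _ + L _) !LE W0 mulr0 add0r.
rewrite [X in _ <= _ + X]big1 ?addr0; last by move=> i _; rewrite M0 mulr0 subr0 mulr0.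
rewrite big1 ?addr0; last first.
  by move=> i _; rewrite /hat !mxE mulrAC mulVf ?gt_eqF// mul1r subrr mulr0.
have Phic : 0 <= B T.
  have [sphi cPhi _ _] := reg.
  have dPhi := differentiable_bregman_generator lambda ((sphi 1%N).1 _ (TX T)).
  have := convex_gradient_le cPhi Tz (TX T) dPhi.
  rewrite /B /bregman; lra.
rewrite mulrC; lra.
Qed.

(** [f] decreases along the flow since its derivative is [- <v, G v>] with
    [v = G^-1 grad f]. *)
Lemma flow_energy_le (R : realType) (d : nat) (lambda : R)
    (Theta : set 'cV[R]_d) (phi f : 'cV[R]_d -> R) (X : R -> 'cV[R]_d) (t : R) :
  lambda != 0 -> open Theta -> regular_clambda_convex lambda Theta phi ->
  Ck 1 Theta f -> continuous X -> (forall s, Theta (X s)) ->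
  (forall s : R, 0 < s -> is_derive s 1 X
     (- (invmx (Gmetric lambda phi (X s)) *m grad f (X s)))) ->
  0 <= t -> f (X t) <= f (X 0).
Proof.
move=> l0 oT reg [df _] cX TX dX t0.
have cfX : {within `[0, t], continuous (fun s => f (X s))}.
  apply: continuous_subspaceT => s; apply: continuous_comp; first exact: cX.
  exact: differentiable_continuous (df _ (TX s)).
apply: (@derive_le0_nonincreasing R _ _ 0 t t0 cfX
  (fun s s0 _ => is_derive_comp_grad (df _ (TX s)) (dX s s0))) => s s0 _.
rewrite innerNr oppr_le0; set G := Gmetric _ _ _; set g := grad _ _.
set v := invmx G *m g; have -> : g = G *m v.
  by rewrite mulmxA mulmxV ?mul1mx//; exact: Gmetric_unitmx reg _.
by rewrite innerC; exact: Gmetric_ge0 reg _.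
Qed.

(** The trajectory stays in a bounded sublevel set of [f], so its closure is
    compact; when this closure lies in [Theta], the continuous positive function
    [exp (lambda phi)] has a positive minimum on it. *)
Lemma flow_weight_lower_bound (R : realType) (d : nat) (lambda : R)
    (Theta : set 'cV[R]_d) (phi f : 'cV[R]_d -> R) (X : R -> 'cV[R]_d)
    (z : 'cV[R]_d) :
  lambda != 0 -> open Theta -> convex_set Theta ->
  regular_clambda_convex lambda Theta phi ->
  Ck 1 Theta f -> strictly_convex Theta f -> minimizer Theta f z ->
  continuous X -> (forall s, Theta (X s)) ->
  (forall s : R, 0 < s -> is_derive s 1 X
     (- (invmx (Gmetric lambda phi (X s)) *m grad f (X s)))) ->
  closure (X @` `[0, +oo[) `<=` Theta ->
  exists2 m : R, 0 < m & forall s : R, 0 <= s -> m <= expR (lambda * phi (X s)).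
Proof.
move=> l0 oT cT reg fC1 scf zmin cX TX dX clT.
have ctf x : Theta x -> {for x, continuous f}.
  by move=> Tx; apply/differentiable_continuous; apply: fC1.1.
have [M XM] := sublevel_bounded (f (X 0)) oT cT ctf scf zmin.
pose K := closure (X @` `[0, +oo[).
have memK (s : R) : 0 <= s -> K (X s).
  by move=> s0; apply: subset_closure; exists s => //=; rewrite in_itv /= s0.
have KB : K `<=` closed_ball_ Num.norm z M.
  have /closure_id -> := @closed_closed_ball_ R _ z M.
  apply: closureS => _ [s /= + <-]; rewrite in_itv /= andbT => s0.
  rewrite /closed_ball_ /= distrC; apply: XM => //.
  exact: flow_energy_le reg fC1 cX TX dX s0.
have cK : compact K.
  apply: cV_bounded_closed_compact; last exact: closed_closure.
  exists (M + `|z|); split; first exact: num_real.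
  move=> N MN y /= /KB; rewrite /closed_ball_ /= distrC => yM.
  rewrite -(subrK z y) (le_trans (ler_normD _ _))//.
  by apply: le_trans (ltW MN); rewrite lerD2r.
have ce : {within K, continuous (fun x => expR (lambda * phi x))}.
  apply: continuous_in_subspaceT => x; rewrite inE => Kx.
  have [sphi _ _ _] := reg.
  have [de _] := is_derive_expR_comp lambda 0 ((sphi 1%N).1 _ (clT _ Kx)).
  exact: differentiable_continuous de.
have [k _ kmin] := compact_EVT_min (ex_intro _ _ (memK 0 (lexx _))) cK ce.
exists (expR (lambda * phi k)) => [|s s0]; first exact: expR_gt0.
by apply: kmin; rewrite inE; exact: memK.
Qed.

Theorem theorem4 (R : realType) (d : nat) (lambda : R)
    (Theta : set 'cV[R]_d) (phi f : 'cV[R]_d -> R)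
    (theta : R -> 'cV[R]_d) (thetastar : 'cV[R]_d)
    (lambda_neq0 : lambda != 0)
    (Theta_open : open Theta)
    (Theta_convex : convex_set Theta)
    (phi_regular : regular_clambda_convex lambda Theta phi)
    (f_C1 : Ck 1 Theta f)
    (f_convex : convex_function Theta f)
    (theta_flow : gradient_flow lambda Theta phi f theta)
    (thetastar_min : minimizer Theta f thetastar) :
  let tau := time_change lambda phi theta in
  let thetahat := time_average lambda phi theta in
  [/\ forall t : R, 0 <= t ->
        has_deriv_ge0 (tau : R -> R^o) t (expR (lambda * phi (theta t))),
      forall t : R, 0 < t ->
        f (thetahat t) - f thetastar <=
        bregman (bregman_generator lambda phi) thetastar (theta 0) / tau t
    & strictly_convex Theta f ->
      closure (theta @` `[0, +oo[) `<=` Theta ->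
      exists C : R, \forall t \near +oo,
        `|f (thetahat t) - f thetastar| <= C / t ].
Proof.
move=> tau thetahat.
pose X (s : R) := theta (Num.max s 0).
have [cX TX XE dX] := gradient_flow_extend theta_flow.
have {}XE (s : R) : 0 <= s -> X s = theta s by exact: XE.
have [sphi cPhi _ _] := phi_regular.
have [Tz fz] := thetastar_min.
pose w s := expR (lambda * phi (X s)).
have w0 s : 0 < w s by exact: expR_gt0.
have cw : continuous w.
  move=> s; have [de _] := is_derive_expR_comp lambda 0 ((sphi 1%N).1 _ (TX s)).
  exact: (continuous_comp (cX s) (differentiable_continuous de)).
have [W [WE dW]] := Rintegral_primitive cw.
have cXw i : continuous (fun s => X s i 0 * w s).
  move=> s; have cXi : {for s, continuous (fun s => X s i 0)}.
    exact: (continuous_comp (cX s) (@coord_continuous _ _ _ i 0 _)).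
  exact: (continuousM cXi (cw s)).
have /choice[M MP] : forall i : 'I_d, exists F : R -> R,
    (forall x : R, 0 <= x ->
       F x = \int[lebesgue_measure]_(s in `[0, x]) (X s i 0 * w s)) /\
    (forall x : R, 0 <= x -> is_derive x 1 F (X x i 0 * w x)).
  by move=> i; exact: Rintegral_primitive.
have tauE (t : R) : 0 <= t -> tau t = W t.
  move=> t0; rewrite WE//; apply: eq_Rintegral => s.
  by rewrite inE /= in_itv /= => /andP[s0 _]; rewrite /w XE.
have hatE (t : R) : 0 <= t -> thetahat t = (W t)^-1 *: \col_i M i t.
  move=> t0; rewrite /thetahat /time_average -/(tau t) tauE//; congr (_ *: _).
  apply/colP => i; rewrite !mxE (MP i).1//; apply: eq_Rintegral => s.
  by rewrite inE /= in_itv /= => /andP[s0 _]; rewrite /w XE.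
have W0 : W 0 = 0 by rewrite WE// set_itv1 Rintegral_set1.
have M0 i : M i 0 = 0 by rewrite (MP i).1// set_itv1 Rintegral_set1.
have W_ge (m T : R) : (forall s, 0 <= s -> m <= w s) -> 0 <= T -> m * T <= W T.
  move=> mw T0.
  have dmW (s : R) : 0 <= s -> is_derive s 1 (m *: id - W) (m *: 1 - w s).
    by move=> s0; have dWs := dW s s0; exact: is_deriveB.
  have cmW : {within `[0, T], continuous (m *: id - W)}.
    apply: derivable_within_continuous => s; rewrite in_itv /= => /andP[s0 _].
    exact: (@ex_derive _ _ _ _ _ _ _ (dmW s s0)).
  have := @derive_le0_nonincreasing R _ _ 0 T T0 cmW (fun s s0 _ => dmW s (ltW s0)).
  have mWE s : (m *: id - W) s = m * s - W s by [].
  rewrite !mWE W0 mulr0 subr0 subr_le0; apply => s s0 _.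
  by rewrite -[_ *: _]/(_ * _) mulr1 subr_le0 mw// ltW.
have W_gt0 (T : R) : 0 < T -> 0 < W T.
  move=> T0.
  have dW0 x : x \in `]0, T[ -> is_derive x 1 W (w x).
    by rewrite in_itv /= => /andP[x0 _]; apply: dW; exact: ltW.
  have [|x _] := MVT T0 dW0.
    apply: derivable_within_continuous => s; rewrite in_itv /= => /andP[s0 _].
    exact: (@ex_derive _ _ _ _ _ _ _ (dW s s0)).
  by rewrite W0 !subr0 => ->; rewrite mulr_gt0.
have Thetahat (t : R) : 0 < t -> Theta (thetahat t).
  move=> t0; rewrite (hatE _ (ltW t0)).
  exact: (weighted_mean_in Theta_open Theta_convex cX (fun s _ => TX s)
    (fun s _ => w0 s) dW (fun i => (MP i).2) t0 W0 M0).
have gap (t : R) : 0 < t -> f (thetahat t) - f thetastar <=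
    bregman (bregman_generator lambda phi) thetastar (theta 0) / W t.
  move=> t0; rewrite ler_pdivlMr ?W_gt0// mulrC -[theta 0]XE//.
  have := Thetahat t t0; rewrite (hatE _ (ltW t0)) => Th.
  apply: (mean_gap_le lambda_neq0 Theta_open phi_regular f_C1 f_convex
    Tz cX TX dX dW _ W0 M0 t0 (W_gt0 t t0) Th) => i s s0.
  exact: (MP i).2.
split.
- move=> t t0; apply: (is_derive_has_deriv_ge0 tauE t0).
  by have := dW t t0; rewrite /w XE.
- by move=> t t0; rewrite (tauE _ (ltW t0)); exact: gap.
move=> scf clT.
have clX : closure (X @` `[0, +oo[) `<=` Theta.
  rewrite (_ : X @` _ = theta @` `[0, +oo[)//.
  apply: eq_imagel => s /=; rewrite in_itv /= andbT; exact: XE.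
have [m m0 mw] := flow_weight_lower_bound lambda_neq0 Theta_open Theta_convex
  phi_regular f_C1 scf thetastar_min cX TX dX clX.
(* [tau t >= m t], so the bound [B 0 / tau t] is at most [(B 0 / m) / t] *)
exists (bregman (bregman_generator lambda phi) thetastar (theta 0) / m).
near=> t; have t0 : 0 < t by near: t; exact: nbhs_pinfty_gt.
rewrite ger0_norm ?subr_ge0; last by apply: fz; exact: Thetahat.
apply: (le_trans (gap t t0)); rewrite -mulrA -invfM.
have B0 : 0 <= bregman (bregman_generator lambda phi) thetastar (theta 0).
  rewrite -[theta 0]XE// /bregman.
  have dPhi := differentiable_bregman_generator lambda ((sphi 1%N).1 _ (TX 0)).
  have := convex_gradient_le cPhi Tz (TX 0) dPhi; lra.
apply: ler_wpM2l => //; rewrite lef_pV2 ?posrE ?mulr_gt0 ?W_gt0//.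
exact: W_ge mw (ltW t0).
Unshelve. all: end_near. Qed.
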